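(* Let $\mathcal M$ be a compact separable metric space with metric $\rho$ and a nonnegative Borel measure $\mu$ with $\mu(\mathcal M)=1$, and suppose $\mathcal M$ is $d$-rectifiable, witnessed by a measure $\nu$, a set $\mathcal O\subset[0,1]^d$ and an injective Lipschitz map $f:\mathcal O\to\mathcal M$ (see context), with Lipschitz constant $\mathrm{Lip}(f)$. Then for every integer $N\ge1$, $$\rho_N(\mathcal M)\ \ge\ N^2\langle\rho\rangle-d\,2^{d-1}\,\mathrm{Lip}(f)\,N^{1-\frac1d}.$$ If, additionally, $\xi$ is a finite nonnegative measure on the set of radii $T$ satisfying $\xi([a,b))\le c_0(\xi)\,|a-b|$ for all $a\le b$, $a,b\in T$, with a constant $c_0(\xi)>0$, then for every $N\ge1$, $$\lambda_N(\xi,\mathcal M)\ \le\ d\,2^{d-2}\,\mathrm{Lip}(f)\,c_0(\xi)\,N^{1-\frac1d}.$$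
   Context: Notation: $B_r(y)=\{x\in\mathcal M:\rho(x,y)\le r\}$; $T=\{\rho(y_1,y_2):y_1,y_2\in\mathcal M\}$ is the set of radii, $T\subset[0,L]$ with $L$ the diameter of $\mathcal M$. $\chi(E,x)$ is the indicator of $x\in E$. An $N$-point distribution is a subset $\mathcal D_N=\{x_1,\dots,x_N\}\subset\mathcal M$. Define $\rho[\mathcal D_N]=\sum_{i,j=1}^N\rho(x_i,x_j)$ and $\langle\rho\rangle=\iint_{\mathcal M\times\mathcal M}\rho(y_1,y_2)\,d\mu(y_1)\,d\mu(y_2)$. The local discrepancy is $\Lambda[B_r(y),\mathcal D_N]=\#(B_r(y)\cap\mathcal D_N)-N\mu(B_r(y))$; set $\lambda_r[\mathcal D_N]=\int_{\mathcal M}\Lambda[B_r(y),\mathcal D_N]^2\,d\mu(y)$ and $\lambda[\xi,\mathcal D_N]=\int_T\lambda_r[\mathcal D_N]\,d\xi(r)$. Then $\rho_N(\mathcal M)=\sup_{\mathcal D_N}\rho[\mathcal D_N]$ and $\lambda_N(\xi,\mathcal M)=\inf_{\mathcal D_N}\lambda[\xi,\mathcal D_N]$, over all $N$-point distributions. $d$-rectifiability: there exist a measure $\nu$ on $I^d=[0,1]^d$ absolutely continuous with respect to Lebesgue measure, a measurable set $\mathcal O\subset I^d$, and an injective map $f:\mathcal O\to\mathcal M$ which is Lipschitz, i.e. $\rho(f(Z_1),f(Z_2))\le c\|Z_1-Z_2\|$ for all $Z_1,Z_2\in\mathcal O$ (Euclidean norm), such that (i) $\mu(\mathcal M\setminus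 f(\mathcal O))=0$ and (ii) $\mu(E)=\nu(f^{-1}(E\cap f(\mathcal O)))$ for every $\mu$-measurable $E\subset\mathcal M$. $\mathrm{Lip}(f)$ denotes the smallest such constant $c$. *)

(* Defs.v *)
From HB Require Import structures.
From mathcomp Require Import all_boot all_order all_algebra finmap.
From mathcomp Require Import all_classical all_reals all_analysis.

Set Implicit Arguments.
Unset Strict Implicit.
Unset Printing Implicit Defensive.

Import Order.TTheory GRing.Theory Num.Theory.
Import numFieldNormedType.Exports.

Local Open Scope classical_set_scope.
Local Open Scope ring_scope.

(* Measurable types carry a distinguished point in the library, hence the
   pointed metric spaces: this only excludes the empty space, on which there
   is no measure of total mass 1. *)
#[short(type="pmetricType")]
HB.structure Definition PMetric (K : numDomainType) :=
  { M of Metric K M & isPointed M }.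

Notation borelType M := (g_sigma_algebraType (@open M)).

Definition separable (T : topologicalType) :=
  exists2 S : set T, countable S & dense S.

(* R^n with the product of the Borel sigma-algebras. *)
Notation Rn R n := (n.-tuple (measurableTypeR R)).

Section lebesgue_measure_Rn.
Context {R : realType}.

Definition tuple_cons n (p : Rn R n * measurableTypeR R) : Rn R n.+1 :=
  [tuple of p.2 :: p.1].

Lemma measurable_tuple_cons n : measurable_fun setT (@tuple_cons n).
Proof. by apply: measurable_cons; [exact: measurable_snd|exact: measurable_fst]. Qed.

Section succ.
Variables (n : nat) (m : {measure set (Rn R n) -> \bar R}).

Definition measure_succ : set (Rn R n.+1) -> \bar R :=
  pushforward (m \x lebesgue_measure)%E (@tuple_cons n).

Let measure_succ0 : measure_succ set0 = 0%E.
Proof. by rewrite /measure_succ /pushforward preimage_set0 measure0. Qed.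

Let measure_succ_ge0 A : (0 <= measure_succ A)%E.
Proof. by rewrite /measure_succ /pushforward; exact: measure_ge0. Qed.

Let measure_succ_semi_sigma_additive : semi_sigma_additive measure_succ.
Proof.
move=> F mF tF mUF; rewrite /measure_succ /pushforward preimage_bigcup.
apply: measure_semi_sigma_additive.
- by move=> k; rewrite -[X in measurable X]setTI; exact: measurable_tuple_cons.
- apply/trivIsetP => /= i j _ _ ij; rewrite -preimage_setI.
  by move/trivIsetP : tF => /(_ _ _ _ _ ij) ->//; rewrite preimage_set0.
- rewrite -preimage_bigcup -[X in measurable X]setTI.
  exact: measurable_tuple_cons.
Qed.

HB.instance Definition _ := isMeasure.Build _ _ _ measure_succ
  measure_succ0 measure_succ_ge0 measure_succ_semi_sigma_additive.

End succ.

(* The n-fold product of the Lebesgue measure of the line. *)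
Fixpoint borel_lebesgue n : {measure set (Rn R n) -> \bar R} :=
  match n with
  | 0 => \d_([tuple] : Rn R 0)
  | n'.+1 => measure_succ (borel_lebesgue n')
  end.

End lebesgue_measure_Rn.

(* R^n with the sigma-algebra of Lebesgue measurable sets; the Lebesgue measure
   on it is [@completed_measure_extension _ _ _ (borel_lebesgue n)]. *)
Notation lebesgueType R n :=
  (caratheodory_type (mu_ext (@borel_lebesgue R n))).

Section rectifiability.
Context {R : realType} {d : nat}.
Implicit Types x y : Rn R d.

Definition unit_cube : set (Rn R d) :=
  [set x | forall i, 0 <= tnth x i <= 1].

Definition edist x y : R := Num.sqrt (\sum_(i < d) (tnth x i - tnth y i) ^+ 2).

Context {M : pmetricType R}.

Definition is_lipschitz (O : set (Rn R d)) (f : Rn R d -> M) (c : R) :=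
  forall x y, O x -> O y -> mdist (f x) (f y) <= c * edist x y.

Definition Lip (O : set (Rn R d)) (f : Rn R d -> M) : R :=
  inf [set c | 0 <= c /\ is_lipschitz O f c].

(* The map f is defined on O: its values outside of O are irrelevant.
   Measures on the unit cube are the measures on R^d that vanish outside of
   it. Since f @` O need not be a Borel set, that its complement has measure 0
   means that it is contained in a Borel set of measure 0. *)
Record rectification (mu : probability (borelType M) R)
    (nu : {measure set (lebesgueType R d) -> \bar R})
    (O : set (lebesgueType R d)) (f : lebesgueType R d -> M) : Prop := {
  rect_cube : nu (~` unit_cube) = 0%E ;
  rect_ac : nu `<< @completed_measure_extension _ _ _ (borel_lebesgue d) ;
  rect_sub : O `<=` unit_cube ;
  rect_measurable : measurable O ;
  rect_inj : set_inj O f ;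
  rect_lip : exists c, is_lipschitz O f c ;
  rect_negligible : mu.-negligible (~` (f @` O)) ;
  rect_measure : forall E : set (borelType M), measurable E ->
    mu E = nu (O `&` f @^-1` (E `&` f @` O)) }.

End rectifiability.

Section distributions.
Context {R : realType} {M : pmetricType R}.
Variable mu : probability (borelType M) R.
Implicit Types (D : {fset M}) (y : M) (r : R) (N : nat).
Implicit Type xi : {measure set (measurableTypeR R) -> \bar R}.

(* Not [closed_ball], which is the closure of the open ball. *)
Definition cball y r : set M := [set x | mdist x y <= r].

Definition radii : set R := range (fun p : M * M => mdist p.1 p.2).

Definition sum_dist D : R := \sum_(x <- D) \sum_(y <- D) mdist x y.

Definition mean_dist : \bar R := \int[(mu \x mu)%E]_p (mdist p.1 p.2)%:E.

Definition sum_dist_sup N : \bar R :=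
  ereal_sup [set (sum_dist D)%:E | D in [set D | #|` D| = N]].

Definition local_discrepancy (B : set M) D : R :=
  #|` [fset x in D | x \in B]%fset |%:R - #|` D|%:R * fine (mu B).

Definition discrepancy r D : \bar R :=
  \int[mu]_y ((local_discrepancy (cball y r) D) ^+ 2)%:E.

Definition mean_discrepancy xi D : \bar R :=
  \int[xi]_(r in radii) discrepancy r D.

Definition discrepancy_inf xi N : \bar R :=
  ereal_inf [set mean_discrepancy xi D | D in [set D | #|` D| = N]].

End distributions.

Arguments radii {R} M.
Arguments sum_dist_sup {R} M N.

(* Main.v *)
Require Import Defs.
From HB Require Import structures.
From mathcomp Require Import all_boot all_order all_algebra finmap.
From mathcomp Require Import all_classical all_reals all_analysis.
From mathcomp Require Import measurable_realfun ring lra.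

Set Implicit Arguments.
Unset Strict Implicit.
Unset Printing Implicit Defensive.

Import Order.TTheory GRing.Theory Num.Theory.
Import numFieldNormedType.Exports.

Local Open Scope classical_set_scope.
Local Open Scope ring_scope.

                                               

(** Both bounds come from one partition of the space into [N] cells of mass 1/N whose diameters have
    a small sum, followed by the choice of one good point in each cell.

    The partition is made in the cube. Hyperplanes are null for [nu], so a set can be cut along a
    coordinate into pieces of any prescribed masses ([atomless_split]). Cutting along the
    coordinates in turn, into at most [k] slabs each time, gives [N] pieces of equal mass whose
    l1-diameters add up to at most [d * k ^ (d - 1)] ([equal_partition]). Taking [k] about the
    [d]-th root of [N], rounded up, and pushing the pieces forward by [f] gives the cells with
    diameter sum at most [b = d 2^(d-1) Lip(f) N^(1-1/d)] ([rectifiable_equal_cells]). Each cell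
    carries a probability measure, and the average of these [N] measures is [mu].

    If one point is drawn independently from each cell, the expected sum of distances is [N^2 <rho>]
    minus the sum of the mean distances inside single cells, which is at most [b]. Some choice does
    at least as well as the mean. The choice is made one point at a time, each no worse than the
    conditional mean ([exists_energy_ge_mean]), so no product of the [N] measures is formed.

    For the discrepancy, the same random points make [Lambda] a sum of independent centred Bernoulli
    variables, and its mean square is the sum of the variances [v (1 - v)]
    ([exists_discrepancy_le_variance]). For a fixed centre, a cell contributes only for radii at
    which the sphere separates its points. These radii lie in an interval no longer than the
    diameter of the cell, and the variance is at most 1/4 there ([variance_le_diameter]). Summing
    over the cells gives [c0 * b / 4]. *)

(** * Cutting a measure with null level sets *)

Lemma measurable_sublevel_le {d} {T : measurableType d} {R : realType}
    (x : T -> R) (t : R) :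
  measurable_fun setT x -> measurable [set z | x z <= t].
Proof.
move=> mx; rewrite (_ : mkset _ = x @^-1` `]-oo, t]); last first.
  by apply/seteqP; split => z /=; rewrite in_itv.
by rewrite -[X in measurable X]setTI; apply: mx => //; exact: measurable_itv.
Qed.

Lemma measurable_level {d} {T : measurableType d} {R : realType}
    (x : T -> R) (t : R) :
  measurable_fun setT x -> measurable [set z | x z = t].
Proof.
move=> mx; rewrite (_ : mkset _ = x @^-1` [set t]); last by [].
by rewrite -[X in measurable X]setTI; exact: mx.
Qed.

(** An intermediate value theorem for the distribution function [t |-> m (F t)]. The cut [t] is the
    supremum of the parameters whose mass is at most [s]. Continuity from below, where the null
    level set closes the gap, gives one inequality, and continuity from above gives the other. *)
Lemma atomless_split {d} {T : measurableType d} {R : realType}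
    (m : {measure set T -> \bar R}) (A : set T) (x : T -> R) (a b : R)
    (s : \bar R) :
  measurable A -> measurable_fun setT x -> (m A < +oo)%E -> a <= b ->
  (forall z, A z -> a <= x z <= b) ->
  (forall t, m (A `&` [set z | x z = t]) = 0%E) ->
  (0 <= s <= m A)%E ->
  exists2 t, a <= t <= b & m (A `&` [set z | x z <= t]) = s.
Proof.
move=> mA mx Aoo ab Aab x0 /andP[s0 sA].
pose F t := A `&` [set z | x z <= t].
have mF t : measurable (F t) by apply: measurableI => //; exact: measurable_sublevel_le.
have ndF t u : t <= u -> F t `<=` F u.
  by move=> tu z [Az /= xt]; split => //=; exact: le_trans tu.
have leF t u : t <= u -> (m (F t) <= m (F u))%E.
  by move=> tu; rewrite le_measure ?inE//; exact: ndF.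
pose S := [set t | a <= t <= b /\ (m (F t) <= s)%E].
have Sa : S a.
  split; first by rewrite lexx.
  suff -> : m (F a) = 0%E by [].
  apply: (subset_measure0 (mF a) _ _ (x0 a)).
    by apply: measurableI => //; exact: measurable_level.
  move=> z [Az /= xa]; split => //=; apply/eqP; rewrite eq_le xa.
  by have /andP[] := Aab _ Az.
have ubS : ubound S b by move=> t [/andP[_ ?] _].
have supS : has_sup S by split; [exists a | exists b].
pose t := sup S; exists t.
  by rewrite ub_le_sup//=; [apply: ge_sup => //; exists a | exists b].
have n0 n : 0 < n.+1%:R^-1 :> R by rewrite invr_gt0.
have Fdec n u : (n <= u)%N -> u.+1%:R^-1 <= n.+1%:R^-1 :> R.
  by move=> nu; rewrite lef_pV2 ?posrE// ler_nat ltnS.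
apply/eqP; rewrite eq_le; apply/andP; split.
- pose G n := F (t - n.+1%:R^-1).
  have mG n : measurable (G n) by exact: mF.
  have UG : \bigcup_n G n = A `&` [set z | x z < t].
    apply/seteqP; split => [z [n _ [Az /= xn]]|z [Az /= xt]].
      by split => //=; apply: le_lt_trans xn _; rewrite ltrBlDr ltrDl.
    have [n xn] := ltr_add_invr xt; exists n => //; split => //=.
    by rewrite lerBrDr ltW.
  have mUG : measurable (\bigcup_n G n) by exact: bigcupT_measurable.
  have cG : (m \o G) @ \oo --> m (\bigcup_n G n).
    apply: nondecreasing_cvg_mu => // n u nu; apply/subsetPset; apply: ndF.
    by rewrite lerD2l lerN2; exact: Fdec.
  have -> : m (A `&` [set z | x z <= t]) = m (\bigcup_n G n).
    have mt : measurable (A `&` [set z | x z = t]).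
      by apply: measurableI => //; exact: measurable_level.
    have -> : A `&` [set z | x z <= t]
        = (\bigcup_n G n) `|` (A `&` [set z | x z = t]).
      rewrite UG -setIUr; congr (_ `&` _); apply/seteqP; split => z /=.
        by rewrite le_eqVlt => /orP[/eqP|]; [right|left].
      by case=> [/ltW//|->].
    rewrite measureU//; first by rewrite -[RHS]adde0; congr (_ + _)%E; exact: x0.
    rewrite UG; apply/seteqP; split => // z [[_ /= zt] [_ /= ztE]].
    by rewrite ztE ltxx in zt.
  rewrite -(cvg_lim _ cG)//; apply: lime_le; first by apply/cvg_ex; eexists; exact: cG.
  apply: nearW => n /=.
  have [u [_ uS] /ltW tu] := sup_adherent (n0 n) supS.
  exact: le_trans (leF _ _ tu) uS.
- pose G n := F (t + n.+1%:R^-1).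
  have mG n : measurable (G n) by exact: mF.
  have IG : \bigcap_n G n = F t.
    apply/seteqP; split => [z Gz|z [Az /= xt] n _]; last first.
      by split => //=; apply: (le_trans xt); rewrite lerDl ltW.
    split; first by have [] := Gz 0%N I.
    rewrite /= leNgt; apply/negP => /ltr_add_invr[n xn].
    by have [_ /=] := Gz n I; rewrite leNgt xn.
  have cG : (m \o G) @ \oo --> m (\bigcap_n G n).
    apply: nonincreasing_cvg_mu => //; first by
      apply: le_lt_trans Aoo; rewrite le_measure ?inE//; exact: subIsetl.
    - by rewrite IG.
    - by move=> n u nu; apply/subsetPset; apply: ndF; rewrite lerD2l; exact: Fdec.
  rewrite -/(F t) -IG -(cvg_lim _ cG)//; apply: lime_ge.
    by apply/cvg_ex; eexists; exact: cG.
  (* A parameter beyond the supremum but still at most [b] is outside [S], hence has mass above [s].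
     A parameter beyond [b] already captures all of [A]. *)
  apply: nearW => n /=; have [tb|bt] := leP (t + n.+1%:R^-1) b.
    rewrite leNgt; apply/negP => Gs.
    have /(ub_le_sup (ex_intro _ b ubS)) : S (t + n.+1%:R^-1).
      split; last exact: ltW.
      rewrite tb andbT (le_trans (_ : a <= t))//; last by rewrite lerDl ltW.
      by apply: ub_le_sup => //; exists b.
    by rewrite -/t leNgt ltrDl n0.
  apply: (le_trans sA); rewrite le_measure ?inE//.
  move=> z Az; split => //=; apply: (le_trans _ (ltW bt)).
  by have /andP[] := Aab _ Az.
Qed.

(** * Equal masses and a small sum of diameters in the cube *)

Section equal_partition.
Context {d} {T : measurableType d} {R : realType} {I : Type}.
Variables (m : {measure set T -> \bar R}) (x : I -> T -> R) (k : nat) (w : R).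
Hypothesis mx : forall i, measurable_fun setT (x i).
Hypothesis x0 : forall i t, m [set z | x i z = t] = 0%E.
Hypothesis w0 : 0 <= w.

                                                                             
                                                                             
                  
(** The partition is encoded by a label function [c]: the cells are the traces on [A] of its fibres.
    The number [e i] bounds the l1-diameter of cell [i], measured only in the coordinates listed in
    [s], which permits induction on [s]. *)
Definition equal_labelling (s : seq I) (n : nat) (A : set T) (c : T -> nat)
    (e : nat -> R) (b : R) :=
  [/\ forall z, (c z < n)%N,
      forall i, measurable (A `&` [set z | c z = i]),
      forall i, (i < n)%N -> m (A `&` [set z | c z = i]) = w%:E,
      forall z z', A z -> A z' -> c z = c z' ->
        \sum_(j <- s) `|x j z - x j z'| <= e (c z)
    & \sum_(i < n) e i <= b].

Lemma equal_labelling_cat (s : seq I) (n1 n2 : nat) (A D : set T) (c1 c2 : T -> nat)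
    (e1 e2 : nat -> R) (b1 b2 : R) :
  equal_labelling s n1 (A `&` D) c1 e1 b1 ->
  equal_labelling s n2 (A `&` ~` D) c2 e2 b2 ->
  exists c e, equal_labelling s (n1 + n2) A c e (b1 + b2).
Proof.
move=> [c1n mc1 wc1 dc1 se1] [c2n mc2 wc2 dc2 se2].
pose c z := if z \in D then c1 z else (n1 + c2 z)%N.
pose e i := if (i < n1)%N then e1 i else e2 (i - n1)%N.
have c1E i : (i < n1)%N -> A `&` [set z | c z = i] = (A `&` D) `&` [set z | c1 z = i].
  move=> i1; apply/seteqP; split => z /=; rewrite /c.
    move=> [Az]; case: ifPn => [zD <-|_ ci]; first by rewrite inE in zD.
    by move: i1; rewrite -ci ltnNge leq_addr.
  by move=> [[Az Dz] <-]; rewrite mem_set.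
have c2E i : (n1 <= i)%N ->
    A `&` [set z | c z = i] = (A `&` ~` D) `&` [set z | c2 z = (i - n1)%N].
  move=> i1; apply/seteqP; split => z /=; rewrite /c.
    move=> [Az]; case: ifPn => [zD ci|zD ci].
      by move: i1; rewrite -ci leqNgt c1n.
    by rewrite notin_setE in zD; rewrite -ci addKn.
  by move=> [[Az Dz] ->]; rewrite memNset// subnKC.
exists c, e; split.
- move=> z; rewrite /c; case: ifPn => _; last by rewrite ltn_add2l.
  by rewrite (leq_trans (c1n z))// leq_addr.
- by move=> i; have [i1|i1] := ltnP i n1; [rewrite c1E|rewrite c2E].
- move=> i i12; have [i1|i1] := ltnP i n1; first by rewrite c1E// wc1.
  by rewrite c2E// wc2// ltn_subLR.
- move=> z z' Az Az'; rewrite /c /e; case: ifPn => zD; case: ifPn => zD' cE.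
  + by rewrite c1n; apply: dc1 => //; split => //; exact: set_mem.
  + by have := c1n z; rewrite cE ltnNge leq_addr.
  + by have := c1n z'; rewrite -cE ltnNge leq_addr.
  + rewrite ltnNge leq_addr/= addKn; apply: dc2.
    * by split => //; rewrite notin_setE in zD.
    * by split => //; rewrite notin_setE in zD'.
    * exact: addnI cE.
- rewrite big_split_ord/=; apply: lerD.
    by under eq_bigr do rewrite /e ltn_ord.
  by under eq_bigr do rewrite /e ltnNge leq_addr/= addKn.
Qed.

(** Induction on the coordinates. Along the first one, [A] is cut into at most [k] slabs of mass at
    most [k ^ size s * w], and the induction hypothesis divides each slab. A slab of a given width
    adds that width to each of its at most [k ^ size s] cells. Since the widths add up to 1, the new
    coordinate costs [k ^ size s] in total, and the old ones cost at most [k] times their previous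
    bound. *)
Lemma equal_partition (s : seq I) (n : nat) (A : set T) :
  (0 < n <= k ^ size s)%N -> measurable A ->
  (forall z, A z -> forall i, 0 <= x i z <= 1) -> m A = (n%:R * w)%:E ->
  exists c e, equal_labelling s n A c e (size s * k ^ (size s).-1)%:R.
Proof.
elim: s n A => [|j s IHs] n A /=.
  rewrite expn0 => n1 mA _ mAw; have {}n1 : n = 1%N by apply/eqP; rewrite eqn_leq andbC.
  rewrite n1 in mAw *; exists (fun=> 0%N), (fun=> 0); split => //.
  - move=> i; have [->|i0] := eqVneq i 0%N.
      by rewrite (_ : [set _ | _] = setT) ?setIT//; apply/seteqP; split.
    rewrite (_ : [set _ | _] = set0) ?setI0//; apply/seteqP; split => //= z.
    by move/eqP; rewrite eq_sym (negbTE i0).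
  - move=> i; rewrite ltnS leqn0 => /eqP ->.
    rewrite (_ : [set _ | _] = setT) ?setIT ?mAw ?mul1r//.
    by apply/seteqP; split.
  - by move=> *; rewrite big_nil.
  - by rewrite big1.
set B := (size s * k ^ (size s).-1)%:R in IHs.
(* The claim is generalised to [l] remaining slabs inside an interval [[a, b]], so that full slabs
   can be peeled off from the left by induction on [l]. *)
suff slabs l : forall n' A' (a b : R), (0 < n' <= l * k ^ size s)%N ->
    measurable A' -> (forall z, A' z -> forall i, 0 <= x i z <= 1) ->
    m A' = (n'%:R * w)%:E -> a <= b -> (forall z, A' z -> a <= x j z <= b) ->
    exists c e, equal_labelling (j :: s) n' A' c e ((b - a) * (k ^ size s)%:R + l%:R * B).
  move=> nk mA cA mAw.
  have := slabs k n A 0 1 _ mA cA mAw ler01 (fun z Az => cA z Az j).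
  rewrite -expnS => /(_ nk) [c [e H]]; exists c, e.
  rewrite (_ : _%:R = (1 - 0) * (k ^ size s)%:R + k%:R * B)//.
  rewrite subr0 mul1r /B mulSn natrD -natrM; congr (_ + _%:R).
  (* The empty list is treated apart because the truncated predecessor [0.-1] is 0; the factor
     [size s] then makes the term vanish. *)
  by case: (size s) => [|p]; rewrite ?muln0 ?mul0n ?muln0//= expnS mulnCA.
elim: l => [|l IHl] n' A' a b.
  by rewrite mul0n leqn0 => /andP[/lt0n_neq0/negbTE ->].
move=> /andP[n0 nl] mA cA mAw ab Aab.
(* If few enough cells remain, the whole of [A'] is the last slab, of width at most [b - a].
   Otherwise a slab holding exactly [k ^ size s] cells is cut off at some [t]. *)
have [nk|kn] := leqP n' (k ^ size s).
  have [|c [e [cn mc wc dc se]]] := IHs n' A' _ mA cA mAw; first by rewrite n0.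
  exists c, (fun i => e i + (b - a)); split => //.
    move=> z z' Az Az' cE; rewrite big_cons addrC lerD//; first exact: dc.
    by have := Aab _ Az; have := Aab _ Az'; rewrite ler_norml; lra.
  rewrite big_split/= sumr_const card_ord -[_ *+ n']mulr_natr [leLHS]addrC; apply: lerD.
    by rewrite ler_wpM2l ?subr_ge0// ler_nat.
  rewrite (le_trans se)// ler_peMl ?ler0n//.
  by rewrite ler1n.
have Aoo : (m A' < +oo)%E by rewrite mAw ltry.
have A0 t : m (A' `&` [set z | x j z = t]) = 0%E.
  apply: (subset_measure0 _ _ _ (x0 j t)) => //.
  + by apply: measurableI => //; exact: measurable_level.
  + exact: measurable_level.
have sA : (0 <= ((k ^ size s)%:R * w)%:E <= m A')%E.
  by rewrite mAw !lee_fin mulr_ge0//= ler_wpM2r// ler_nat ltnW.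
have [t /andP[at_ tb] mt] := atomless_split mA (mx j) Aoo ab Aab A0 sA.
have mD := measurable_sublevel_le t (mx j).
set D := [set z | x j z <= t] in mt mD.
have k0 : (0 < k ^ size s)%N.
  by move: (leq_trans n0 nl); rewrite muln_gt0 => /andP[].
have mAC : m (A' `&` ~` D) = ((n' - k ^ size s)%:R * w)%:E.
  transitivity (m A' - m (A' `&` D))%E; first by rewrite -setDE; exact: measureD.
  rewrite mAw mt natrB 1?ltnW// mulrBl EFinB//.
have n1 : (0 < k ^ size s <= k ^ size s)%N by rewrite k0/=.
have [c1 [e1 [cn1 mc1 wc1 dc1 se1]]] := IHs _ _ n1 (measurableI _ _ mA mD)
  (fun z Az => cA z Az.1) mt.
have n2 : (0 < n' - k ^ size s <= l * k ^ size s)%N.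
  by rewrite subn_gt0 kn leq_subLR -mulSn.
have A2 z : (A' `&` ~` D) z -> t <= x j z <= b.
  move=> [Az /= Dz]; have /andP[_ ->] := Aab _ Az.
  by rewrite andbT ltW// ltNge; apply/negP.
have [c2 [e2 H2]] := IHl _ _ t b n2 (measurableI _ _ mA (measurableC mD))
  (fun z Az => cA z Az.1) mAC tb A2.
have H1 : equal_labelling (j :: s) (k ^ size s) (A' `&` D) c1
    (fun i => e1 i + (t - a)) ((t - a) * (k ^ size s)%:R + B).
  split => //.
    move=> z z' Az Az' cE; rewrite big_cons addrC lerD//; first exact: dc1.
    have := Aab _ Az.1; have := Aab _ Az'.1; have := Az.2; have := Az'.2.
    by rewrite /D/= ler_norml; lra.
  by rewrite big_split/= sumr_const card_ord -[_ *+ (k ^ _)]mulr_natr [leLHS]addrC lerD.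
have [c [e]] := equal_labelling_cat H1 H2; rewrite subnKC 1?ltnW// => H.
exists c, e; rewrite (_ : _ + _ = (t - a) * (k ^ size s)%:R + B +
  ((b - t) * (k ^ size s)%:R + l%:R * B))//.
by rewrite -[in LHS]natr1; ring.
Qed.

End equal_partition.

(** * Coordinate hyperplanes are null *)

Lemma caratheodory_measurable_borel {R : realType} {d : nat} (A : set (Rn R d)) :
  measurable A -> measurable (A : set (lebesgueType R d)).
Proof. by move=> mA; exact: caratheodory_measurable_mu_ext. Qed.

Lemma measurable_coordinate {R : realType} {d : nat} (i : 'I_d) :
  measurable_fun setT (fun z : lebesgueType R d => tnth z i : R).
Proof.
move=> _ B mB; apply: caratheodory_measurable_borel.
have : measurable_fun setT (fun z : Rn R d => tnth z i) by exact: measurable_tnth.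
exact.
Qed.

(** Induction on the dimension. [tuple_cons] puts the second factor of the product in front, so for
    coordinate 0 the hyperplane is the whole space times a point, and for the other coordinates it
    is a lower-dimensional hyperplane times the line. *)
Lemma borel_lebesgue_hyperplane {R : realType} {d : nat} (i : 'I_d) (t : R) :
  borel_lebesgue d [set z | tnth z i = t] = 0%E.
Proof.
elim: d i => [[]//|d IHd] i.
have mt : measurable [set t] by exact: measurable_set1.
rewrite /= /measure_succ /pushforward/=.
have [j ->|->] := unliftP ord0 i; last first.
  rewrite (_ : _ @^-1` _ = setT `*` [set t]).
    rewrite product_measure1E// [X in (_ * X)%E](_ : _ = 0%E) ?mule0//.
    exact: lebesgue_measure_set1.
  by apply/seteqP; split => -[x y] /=; rewrite /tuple_cons tnth0; [|case].
rewrite (_ : _ @^-1` _ = [set z | tnth z j = t] `*` setT).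
  rewrite product_measure1E ?IHd ?mul0e//.
  rewrite (_ : mkset _ = (fun z : Rn R d => tnth z j) @^-1` [set t]); last by [].
  rewrite -[X in measurable X]setTI.
  by apply: measurable_tnth.
by apply/seteqP; split => -[x y] /=; rewrite /tuple_cons tnthS//; case.
Qed.

Lemma lebesgue_hyperplane {R : realType} {d : nat}
    (nu : {measure set (lebesgueType R d) -> \bar R}) (i : 'I_d) (t : R) :
  nu `<< @completed_measure_extension _ _ _ (borel_lebesgue d) ->
  nu [set z | tnth z i = t] = 0%E.
Proof.
move/null_content_dominatesP; apply.
  exact: (@measurable_level _ _ _ _ t (measurable_coordinate i)).
have mH : measurable [set z : Rn R d | tnth z i = t].
  exact: (@measurable_level _ (Rn R d) _ _ t (measurable_tnth i)).
exact: etrans (measurable_mu_extE (borel_lebesgue d) mH) (borel_lebesgue_hyperplane i t).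
Qed.

                                                             

(** * Measurability of the distance, compactness of the set of radii *)

Lemma measurable_fun_sublevel {d} {T : measurableType d} {R : realType} (g : T -> R) :
  (forall t, measurable [set x | g x < t]) -> measurable_fun setT g.
Proof.
move=> mg; apply: (measurability (@RGenInftyO.G R)).
  exact: RGenInftyO.measurableE.
move=> _ [_ [t ->] <-]; rewrite setTI.
rewrite (_ : _ @^-1` _ = [set x | g x < t]) //.
Qed.

Section metric_space.
Context {R : realType} {M : pmetricType R}.

Lemma mdist_sym (x y : M) : mdist x y = mdist y x.
Proof. exact: (@metric_sym R M). Qed.

Lemma mdist_triangle (x y z : M) : mdist x z <= mdist x y + mdist y z.
Proof. exact: (@metric_triangle R M). Qed.

Lemma mdist_self (x : M) : mdist x x = 0 :> R.
Proof. exact: (@mdistxx R M). Qed.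

Lemma open_mball (x : M) (r : R) : open [set y : M | mdist x y < r].
Proof.
rewrite openE => y /= xy; rewrite /interior.
have r0 : 0 < r - mdist x y by rewrite subr_gt0.
apply: filterS (nbhsx_ballx y _ r0) => z; rewrite ballEmdist/= => yz.
by apply: le_lt_trans (mdist_triangle x y z) _; lra.
Qed.

Lemma dense_sequence : separable M ->
  exists q : nat -> M, forall x e, 0 < e -> exists n, mdist x (q n) < e.
Proof.
move=> [S /pcard_surjP[q qS] dS]; exists q => x e e0.
have [||y [/= xy /qS [n _ ny]]] := dS [set y | mdist x y < e].
- by exists x => /=; rewrite mdist_self.
- exact: open_mball.
- by exists n; rewrite ny.
Qed.

Lemma measurable_mball (x : M) (r : R) :
  measurable ([set y | mdist x y < r] : set (borelType M)).
Proof. by apply: sub_sigma_algebra; exact: open_mball. Qed.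

(** The sigma-algebra is the product of the Borel ones, so openness of the sublevel sets does not
    suffice. Separability writes each of them as a countable union of products of two balls about a
    common point of a dense sequence, with rational [a] splitting the bound [t]. *)
Lemma measurable_mdist : separable M ->
  measurable_fun setT (fun p : borelType M * borelType M => mdist (p.1 : M) p.2 : R).
Proof.
move=> /dense_sequence[q qd]; apply: measurable_fun_sublevel => t.
pose F (na : nat * rat) : set (borelType M * borelType M) :=
  [set y | mdist (q na.1) y < ratr na.2] `*`
  [set y | mdist (q na.1) y < t - ratr na.2].
rewrite (_ : mkset _ = \bigcup_na F na).
  apply: countable_bigcupT_measurable => // na.
  by apply: measurableX; exact: measurable_mball.
apply/seteqP; split => [[x y] /= xy|[x y] [[n a] _ [/= nx ny]]]; last first.
  by have := mdist_triangle x (q n) y; rewrite (mdist_sym x (q n)); lra.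
have [a] : exists a : rat, ratr a \in `]0, (t - mdist x y) / 2[.
  by apply: rat_in_itvoo; lra.
rewrite in_itv/= => /andP[a0 at_].
have [n xn] := qd x _ a0.
exists (n, a) => //; split => /=; first by rewrite mdist_sym.
by have := mdist_triangle (q n) x y; rewrite (mdist_sym (q n) x); lra.
Qed.

Hypothesis cM : compact [set: M].

Lemma continuous_mdist : continuous (fun p : M * M => mdist p.1 p.2 : R).
Proof.
move=> [x y] /=; apply/cvgrPdist_lt => e e0.
have e2 : 0 < e / 2 by rewrite divr_gt0.
exists (ball x (e / 2), ball y (e / 2)).
  by split; exact: nbhsx_ballx.
move=> [x' y'] [/=]; rewrite !ballEmdist/= => xx' yy'.
have := mdist_triangle x x' y; have := mdist_triangle x' y' y.
have := mdist_triangle x' x y'; have := mdist_triangle x y y'.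
rewrite (mdist_sym x' x) (mdist_sym y' y) => *.
by rewrite ltr_norml; lra.
Qed.

Lemma compact_radii : compact (radii M).
Proof.
apply: continuous_compact; first by apply: continuous_subspaceT; exact: continuous_mdist.
by rewrite -setXTT; exact: compact_setX.
Qed.

Lemma closed_radii : closed (radii M).
Proof. by apply: compact_closed => //; exact: compact_radii. Qed.

Lemma mdist_bounded : exists L : R, forall x y : M, mdist x y <= L.
Proof.
have [L [_ HL]] := compact_bounded compact_radii.
exists (L + 1) => x y; apply: le_trans (ler_norm _) _.
by apply: HL; [rewrite ltrDl|exists (x, y)].
Qed.

End metric_space.

(** * Lipschitz maps on subsets of the cube *)

Section rectifiable_image.
Context {R : realType} {d : nat} {M : pmetricType R}.
Implicit Types (x y : Rn R d).

Lemma edist_ge0 x y : 0 <= Defs.edist x y.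
Proof. exact: sqrtr_ge0. Qed.

Lemma edist_le_sum x y : Defs.edist x y <= \sum_(i < d) `|tnth x i - tnth y i|.
Proof.
suff [s0 ss] : 0 <= \sum_(i < d) `|tnth x i - tnth y i| /\
    \sum_(i < d) (tnth x i - tnth y i) ^+ 2 <= (\sum_(i < d) `|tnth x i - tnth y i|) ^+ 2.
  by rewrite /Defs.edist -[leRHS](ger0_norm s0) -sqrtr_sqr ler_sqrt ?sqr_ge0.
elim/big_ind2 : _ => [|a a' b b' [a0 aa] [b0 bb]|i _]; first by rewrite expr0n.
  by split; nra.
by rewrite real_normK ?num_real.
Qed.

(** The infimum defining [Lip] is itself a Lipschitz constant: for points at positive distance,
    every admissible constant is at least the quotient of the two distances. Points at distance 0
    are handled by any given constant. *)
Lemma le_Lip (O : set (Rn R d)) (f : Rn R d -> M) x y :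
  (exists c, is_lipschitz O f c) -> O x -> O y ->
  mdist (f x) (f y) <= Lip O f * Defs.edist x y.
Proof.
move=> [c fc] Ox Oy.
have [exy|exy] := ltP 0 (Defs.edist x y); last first.
  have -> : Defs.edist x y = 0 by apply/eqP; rewrite eq_le exy edist_ge0.
  rewrite mulr0 (le_trans (fc _ _ Ox Oy))//.
  have -> : Defs.edist x y = 0 by apply/eqP; rewrite eq_le exy edist_ge0.
  by rewrite mulr0.
rewrite -ler_pdivrMr//; apply: lb_le_inf => [|e [e0 fe]/=]; last first.
  by rewrite ler_pdivrMr//; exact: fe.
exists `|c|; split => // u v Ou Ov; apply: (le_trans (fc _ _ Ou Ov)).
by rewrite ler_wpM2r ?edist_ge0// ler_norm.
Qed.

Lemma Lip_ge0 (O : set (Rn R d)) (f : Rn R d -> M) :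
  (exists c, is_lipschitz O f c) -> 0 <= Lip O f.
Proof.
move=> [c fc]; apply: lb_le_inf => [|e []//].
exists `|c|; split => // u v Ou Ov; apply: (le_trans (fc _ _ Ou Ov)).
by rewrite ler_wpM2r ?edist_ge0// ler_norm.
Qed.

(** The preimage is a countable union of traces on [O] of rational boxes, namely of those boxes
    whose trace is mapped into [U]. The Lipschitz bound shows that a small enough box around each
    point of the preimage qualifies. *)
Lemma measurable_lipschitz_preimage (O : set (lebesgueType R d))
    (f : lebesgueType R d -> M) (U : set M) :
  (exists c, is_lipschitz O f c) -> measurable O -> open U ->
  measurable (O `&` f @^-1` U).
Proof.
move=> fc mO oU.
pose box (qr : d.-tuple rat * rat) : set (lebesgueType R d) :=
  [set z | forall i : 'I_d, `|tnth z i - ratr (tnth qr.1 i)| < ratr qr.2].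
have mbox qr : measurable (box qr).
  rewrite (_ : box qr = ~` \bigcup_(i : 'I_d)
      ~` [set z | `|tnth z i - ratr (tnth qr.1 i)| < ratr qr.2]).
    apply: measurableC; apply: countable_bigcupT_measurable => // i.
    apply: measurableC.
    rewrite (_ : mkset _ = (fun z : lebesgueType R d => tnth z i : R) @^-1`
        `]ratr (tnth qr.1 i) - ratr qr.2, ratr (tnth qr.1 i) + ratr qr.2[).
      rewrite -[X in measurable X]setTI.
      exact: (measurable_coordinate i measurableT (measurable_itv _)).
    by apply/seteqP; split => z /=; rewrite in_itv/= ltr_norml; lra.
  rewrite setC_bigcup; apply/seteqP; split => z zb i.
    by move=> _; rewrite setCK; exact: zb.
  by have := zb i I; rewrite setCK.
pose F qr := [set z | (O `&` box qr `<=` f @^-1` U) /\ (O `&` box qr) z].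
rewrite (_ : _ `&` _ = \bigcup_qr F qr).
  apply: countable_bigcupT_measurable => // qr.
  have [OU|nOU] := pselect (O `&` box qr `<=` f @^-1` U).
    rewrite (_ : F qr = O `&` box qr); first exact: measurableI.
    by apply/seteqP; split => z; [case|].
  rewrite (_ : F qr = set0)//; apply/seteqP; split => z //; by case.
apply/seteqP; split => [z [Oz /= fzU]|z [qr _ [OU [Oz zb]]]]; last first.
  by split => //; exact: OU.
have /nbhs_ballP[e /= e0 eU] : nbhs (f z) U by move: oU; rewrite openE; exact.
have L0 := Lip_ge0 fc.
(* Two points of a box of half-width [r] are within [2 * d * r] in the l1-norm. The shifts
   [Lip O f + 1] and [d.+1] keep the denominator positive when [Lip O f] or [d] is 0. *)
have K0 : 0 < (Lip O f + 1) * (2 * d.+1%:R) by rewrite mulr_gt0// ?mulr_gt0//; lra.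
have [r] : exists r : rat, ratr r \in `]0, e / ((Lip O f + 1) * (2 * d.+1%:R))[.
  by apply: rat_in_itvoo; rewrite divr_gt0.
rewrite in_itv/= => /andP[r0 re].
have qP (i : 'I_d) : {q : rat | ratr q \in `]tnth z i - ratr r, tnth z i + ratr r[}.
  by apply/cid/rat_in_itvoo; lra.
exists ([tuple sval (qP i) | i < d], r) => //; split; last first.
  split => // i; rewrite tnth_mktuple; case: (qP i) => q /=.
  by rewrite in_itv/= ltr_norml; lra.
move=> z' [Oz' zb']; apply: eU; rewrite ballEmdist/=.
apply: (le_lt_trans (le_Lip fc Oz Oz')).
have : Defs.edist z z' <= 2 * d.+1%:R * ratr r.
  apply: (le_trans (edist_le_sum z z')).
  apply: (@le_trans _ _ (\sum_(i < d) (2 * ratr r))).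
    apply: ler_sum => i _.
    have := zb' i; rewrite /= tnth_mktuple; case: (qP i) => q /=.
    rewrite in_itv/= => /andP[? ?] zq.
    by rewrite ler_norml; move: zq; rewrite ltr_norml; lra.
  rewrite sumr_const card_ord -[leLHS]mulr_natr -natr1.
  have : 0 <= d%:R :> R by [].
  nra.
move=> /(ler_wpM2l L0) /le_lt_trans; apply.
rewrite ltr_pdivlMr// in re.
apply: le_lt_trans re; rewrite -natr1.
have : 0 <= d%:R :> R by [].
by have := r0; nra.
Qed.

(** The values of [f] outside [O] are arbitrary. Replacing them by a constant gives a globally
    measurable map, along which measures can be pushed forward. *)
Lemma measurable_lipschitz_patch (O : set (lebesgueType R d))
    (f : lebesgueType R d -> M) :
  (exists c, is_lipschitz O f c) -> measurable O ->
  measurable_fun setT ((fun z => if z \in O then f z else point) :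
    lebesgueType R d -> borelType M).
Proof.
move=> fc mO.
apply: (@measurability _ _ (lebesgueType R d) (borelType M) setT _ (@open M)) => //.
move=> _ [U oU <-]; rewrite setTI.
set f' := fun z => _.
have mfU := measurable_lipschitz_preimage fc mO oU.
have [pU|pU] := pselect (U point).
  rewrite (_ : f' @^-1` U = (O `&` f @^-1` U) `|` ~` O).
    by apply: measurableU => //; exact: measurableC.
  apply/seteqP; split => z /=; rewrite /f'.
    by case: ifPn; rewrite ?inE ?notin_setE; [left|right].
  by case=> [[Oz fz]|nOz]; [rewrite mem_set|rewrite memNset].
rewrite (_ : f' @^-1` U = O `&` f @^-1` U)//.
apply/seteqP; split => z /=; rewrite /f'.
  by case: ifPn => //; rewrite inE.
by move=> [Oz fz]; rewrite mem_set.
Qed.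

End rectifiable_image.

                                                      

(** * Transport of the cells to the metric space *)

Lemma exists_scaled_image {d d'} {T : measurableType d} {T' : measurableType d'}
    {R : realType} (m : {measure set T -> \bar R}) (P0 : probability T' R)
    (g : T -> T') (A : set T) (w : R) :
  measurable A -> measurable_fun setT g -> 0 < w -> m A = w^-1%:E ->
  exists P : probability T' R, forall E, P E = (w%:E * m (A `&` g @^-1` E))%E.
Proof.
move=> mA mg w0 mAw.
pose mu :=
  measure_function_pushforward__canonical__measure_function_Measure (mrestr m mA) mg.
(* [P0] is only the default of [mnormalize] for mass zero or infinite. Here the mass is [w^-1], so
   normalising multiplies by [w]. *)
exists (mnormalize mu P0) => E; rewrite /= /mnormalize.
have muE F : mu F = m (A `&` g @^-1` F) by rewrite /mu/= /pushforward/mrestr setIC.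
rewrite !muE preimage_setT setIT mAw eqe invr_eq0 gt_eqF//= invrK muleC.
by rewrite -muE.
Qed.

(** With [t] the [d]-th root of [N], take [k] to be the integer part of [t] plus one. Then
    [t < k <= t + 1 <= 2 * t] because [t >= 1]; this is the source of the factor [2 ^ (d - 1)]. *)
Lemma exists_root_upper {R : realType} (d N : nat) : (0 < d)%N -> (0 < N)%N ->
  exists2 k : nat, (N <= k ^ d)%N &
    (k ^ d.-1)%:R <= 2 ^+ d.-1 * N%:R `^ (1 - d%:R^-1) :> R.
Proof.
move=> d0 N0; pose t : R := N%:R `^ d%:R^-1.
have t1 : 1 <= t by rewrite -[leLHS](powRr0 N%:R) ler_powR ?ler1n ?invr_ge0.
have td : t ^+ d = N%:R.
  by rewrite -powR_mulrn ?powR_ge0// -powRrM mulVf ?powRr1// pnatr_eq0 -lt0n.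
have td1 : t ^+ d.-1 = N%:R `^ (1 - d%:R^-1).
  rewrite -powR_mulrn ?powR_ge0// -powRrM; congr (_ `^ _).
  have d1 : d%:R != 0 :> R by rewrite pnatr_eq0 -lt0n.
  by rewrite -subn1 natrB// mulrBr mulVf// mulr1.
exists (Num.truncn t).+1.
  rewrite -(ler_nat R) -td natrX lerXn2r ?nnegrE// ?(le_trans _ t1)//.
  exact: ltW (truncnS_gt _).
rewrite natrX -td1 -exprMn lerXn2r ?nnegrE// ?mulr_ge0 ?powR_ge0//.
have : (Num.truncn t)%:R <= t by rewrite truncn_le (le_trans _ t1).
by rewrite -natr1; lra.
Qed.

Section equal_cells.
Context {R : realType} {M : pmetricType R}.
Variable mu : probability (borelType M) R.

                                                                              
                       
(** The measure [P i] plays the role of [mu] conditioned on cell [V i]. A cell is an image under [f]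
    and need not be Borel, so [P i] being concentrated on it is expressed through its measurable
    supersets. *)
Record equal_cells (N : nat) (P : nat -> probability (borelType M) R)
    (V : nat -> set M) (e : nat -> R) (b : R) : Prop := {
  cell_full : forall i (E : set (borelType M)), (i < N)%N -> measurable E ->
    V i `<=` E -> P i (~` E) = 0%E ;
  cell_disjoint : forall i j y, (i < N)%N -> (j < N)%N -> V i y -> V j y -> i = j ;
  cell_diam : forall i y y', (i < N)%N -> V i y -> V i y' -> mdist y y' <= e i ;
  cell_sum : \sum_(i < N) e i <= b ;
  cell_average : forall E : set (borelType M), measurable E ->
    (\sum_(i < N) P i E = N%:R%:E * mu E)%E }.

(** The cells are the images under [f] of the pieces of [O], and [P i] is [N] times the image of
    [nu] restricted to piece [i]. Injectivity of [f] makes the cells disjoint, and diameters grow by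
    at most [Lip O f], the Euclidean norm being bounded by the l1-norm. *)
Lemma rectifiable_equal_cells (d : nat)
    (nu : {measure set (lebesgueType R d) -> \bar R})
    (O : set (lebesgueType R d)) (f : lebesgueType R d -> M) (N : nat) :
  (0 < d)%N -> rectification mu nu O f -> (0 < N)%N ->
  exists P V e, equal_cells N P V e
    (d%:R * 2 ^+ d.-1 * Lip O f * N%:R `^ (1 - d%:R^-1)).
Proof.
move=> d0 rect N0; have [k Nk kd] := @exists_root_upper R d N d0 N0.
have mO := rect_measurable rect.
have mf := measurable_lipschitz_patch (rect_lip rect) mO.
set f' := fun z => _ in mf.
have f'E z : O z -> f' z = f z by move=> Oz; rewrite /f' mem_set.
have muE (E : set (borelType M)) : measurable E -> mu E = nu (O `&` f' @^-1` E).
  move=> mE; rewrite (rect_measure rect mE); congr (nu _).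
  apply/seteqP; split => z /= [Oz]; rewrite f'E//; first by case.
  by move=> Ez; split => //; split => //; exists z.
have nuO : nu O = (N%:R * N%:R^-1)%:E.
  rewrite mulfV ?pnatr_eq0 -?lt0n//.
  by rewrite -(probability_setT mu) muE// preimage_setT setIT.
have NV0 : 0 <= N%:R^-1 :> R by rewrite invr_ge0.
pose x (i : 'I_d) (z : lebesgueType R d) : R := tnth z i.
have mx i : measurable_fun setT (x i) := measurable_coordinate i.
have x0 i t : nu [set z | x i z = t] = 0%E := lebesgue_hyperplane i t (rect_ac rect).
have Nk' : (0 < N <= k ^ size (enum 'I_d))%N by rewrite N0 size_enum_ord.
have Ox z : O z -> forall i, 0 <= x i z <= 1 by move=> /(rect_sub rect).
have [c [e [cN mc wc dc se]]] := equal_partition mx x0 NV0 Nk' mO Ox nuO.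
have PP i : exists P : probability (borelType M) R, (i < N)%N -> forall E,
    P E = (N%:R%:E * nu ((O `&` [set z | c z = i]) `&` f' @^-1` E))%E.
  have [iN|iN] := ltnP i N; last by exists mu.
  have [|P PE] := @exists_scaled_image _ _ _ _ _ nu mu f' _ N%:R (mc i) mf _ (wc i iN).
    by rewrite ltr0n.
  by exists P.
pose V i := f @` (O `&` [set z | c z = i]).
have [P PE] := choice PP.
exists P, V, (fun i => Lip O f * e i); split.
- move=> i E iN mE VE; rewrite PE// (_ : _ `&` _ = set0) ?measure0 ?mule0//.
  apply/seteqP; split => // z [[Oz cz] /=]; rewrite f'E//; apply.
  by apply: VE; exists z.
- move=> i j y iN jN [z [Oz /= zi] <-] [z' [Oz' /= zj] /(rect_inj rect)].
  by rewrite !inE => /(_ Oz' Oz) zz; rewrite -zi -zj zz.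
- move=> i _ _ iN [z [Oz /= zi] <-] [z' [Oz' /= zj] <-].
  apply: (le_trans (le_Lip (rect_lip rect) Oz Oz')).
  rewrite ler_wpM2l ?(Lip_ge0 (rect_lip rect))// (le_trans (edist_le_sum z z'))//.
  have := dc _ _ Oz Oz'; rewrite zi zj => /(_ erefl).
  by rewrite big_enum.
- rewrite -mulr_sumr [leRHS]mulrAC [leRHS]mulrC.
  rewrite ler_wpM2l ?(Lip_ge0 (rect_lip rect))//.
  apply: (le_trans se); rewrite size_enum_ord natrM -mulrA.
  by rewrite ler_wpM2l.
- move=> E mE.
  have mfE : measurable (f' @^-1` E) by rewrite -[X in measurable X]setTI; exact: mf.
  under eq_bigr do rewrite PE//.
  rewrite -ge0_sume_distrr//; congr (_ * _)%E; rewrite muE//.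
  pose G i := (O `&` [set z | c z = i]) `&` f' @^-1` E.
  have mG i : measurable (G i) by exact: measurableI.
  have tG : trivIset setT G.
    by move=> i j _ _ [z [[[_ /= <-] _] [[_ /= <-] _]]].
  rewrite -(measure_bigsetU nu mG tG) -bigcup_mkord.
  congr (nu _); apply/seteqP; split => z; first by case=> i _ [[]].
  by move=> [Oz fz]; exists (c z) => //=; exact: cN.
Qed.

End equal_cells.

                                                     

(** * Points that do at least as well as the mean *)

Section mean_value.
Context {d} {T : measurableType d} {R : realType}.
Variables (P : probability T R) (V : set T).
Hypothesis fullV : forall E, measurable E -> V `<=` E -> P (~` E) = 0%E.

(** If [g] exceeded its mean [r] on all of [V], the measurable set where [g > r] would contain [V]
    and so have probability 1. But [g - r] is positive there and has integral 0, so this set is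
    null. *)
Lemma exists_le_mean (g : T -> \bar R) :
  measurable_fun setT g -> (forall x, 0 <= g x)%E ->
  exists2 x, V x & (g x <= \int[P]_x g x)%E.
Proof.
move=> mg g0; apply: contrapT => nex.
have VP x : V x -> (\int[P]_x g x < g x)%E.
  by move=> Vx; rewrite ltNge; apply/negP => gx; apply: nex; exists x.
move: VP; have : (0 <= \int[P]_x g x)%E by exact: integral_ge0.
(* With an infinite mean, the negated claim forces [V] to be empty, so the total mass would be 0. *)
case sE : (\int[P]_x g x)%E => [r| |]//= r0 VP; last first.
  have := @fullV set0 measurable0; rewrite setC0 probability_setT.
  suff V0 : V `<=` set0 by move=> /(_ V0)/eqP; rewrite onee_eq0.
  by move=> x /VP; rewrite ltNge leey.
pose E := [set x | (r%:E < g x)%E].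
have mE : measurable E.
  by rewrite -[E]setTI; exact: emeasurable_fun_o_infty.
have PE := fullV mE VP.
have mCE : measurable (~` E) by exact: measurableC.
have mgE : measurable_fun E (fun x => g x - r%:E)%E.
  by apply: emeasurable_funB => //; exact: measurable_funTS.
have PE1 : P E = 1%E.
  have := probability_setC P mCE; rewrite setCK => ->.
  by rewrite PE sube0.
have X0 : (\int[P]_(x in E) (g x - r%:E) = 0)%E.
  have Er : (\int[P]_(x in E) r%:E = r%:E)%E.
    transitivity (r%:E * P E)%E; first exact: (@integral_cst _ _ _ P E mE).
    by rewrite PE1 mule1.
  have : (\int[P]_(x in E) (g x - r%:E) + \int[P]_(x in E) r%:E = r%:E)%E.
    rewrite -ge0_integralD//.
      rewrite -[RHS]sE (ge0_negligible_integral mCE measurableT mg _ PE)// setTD setCK.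
      by apply: eq_integral => x _; rewrite subeK.
    by move=> x Ex; rewrite sube_ge0// ltW.
  rewrite Er.
  move=> /(congr1 (fun z => z - r%:E)%E); rewrite addeK// subee//.
have : (\int[P]_(x in E) `|g x - r%:E| = 0)%E.
  rewrite -X0; apply: eq_integral => x /[!inE] Ex.
  by rewrite gee0_abs// sube_ge0// ltW.
move=> /(ae_eq_integral_abs P mE mgE)[N [mN PN EN]].
suff : (P E <= P N)%E by rewrite PE1 PN lee_fin ler10.
apply: le_measure; rewrite ?inE// => x Ex; apply: EN => /= /(_ Ex) gx.
by have : (0 < g x - r%:E)%E; [rewrite sube_gt0|rewrite gx ltxx].
Qed.

Lemma exists_ge_Rmean (g : T -> R) (L : R) :
  measurable_fun setT g -> (forall x, `|g x| <= L) ->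
  exists2 x, V x & \int[P]_x g x <= g x.
Proof.
move=> mg gL.
have ig : P.-integrable setT (EFin \o g).
  apply: measurable_bounded_integrable => //.
    exact: (le_lt_trans (probability_le1 P measurableT) (ltry 1)).
  by exists L; split; rewrite ?num_real// => M LM x _; exact: le_trans (ltW LM).
have [||x Vx] := @exists_le_mean (fun x => (L - g x)%:E).
- by apply/measurable_EFinP; exact: measurable_funB.
- by move=> x; rewrite lee_fin subr_ge0 (le_trans (ler_norm _)).
rewrite (_ : (\int[P]_x _)%E = (L - \int[P]_x g x)%:E).
  by rewrite lee_fin lerD2l lerN2; exists x.
under eq_integral do rewrite EFinB.
rewrite integralB_EFin//; last exact: finite_measure_integrable_cst.
by rewrite integral_cst//= probability_setT mule1 EFinB fineK// integrable_fin_num.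
Qed.

End mean_value.

Section bounded_mean.
Context {d} {T : measurableType d} {R : realType}.
Implicit Types (P Q : probability T R) (g h : T -> R).

Definition bounded_measurable g :=
  measurable_fun setT g /\ exists L, forall x, `|g x| <= L.

Lemma bounded_measurable_integrable P g :
  bounded_measurable g -> P.-integrable setT (EFin \o g).
Proof.
move=> [mg [L gL]]; apply: measurable_bounded_integrable => //.
  exact: (le_lt_trans (probability_le1 P measurableT) (ltry 1)).
by exists L; split; rewrite ?num_real// => u Lu x _; exact: le_trans (ltW Lu).
Qed.

Lemma bounded_measurableD g h :
  bounded_measurable g -> bounded_measurable h ->
  bounded_measurable (fun x => g x + h x).
Proof.
move=> [mg [L gL]] [mh [K hK]]; split; first exact: measurable_funD.
by exists (L + K) => x; rewrite (le_trans (ler_normD _ _))// lerD.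
Qed.

Lemma bounded_measurableZ c g :
  bounded_measurable g -> bounded_measurable (fun x => c * g x).
Proof.
move=> [mg [L gL]]; split; first exact: measurable_funM.
by exists (`|c| * L) => x; rewrite normrM ler_wpM2l.
Qed.

Lemma bounded_measurable_sum n (g : nat -> T -> R) :
  (forall i, bounded_measurable (g i)) ->
  bounded_measurable (fun x => \sum_(i < n) g i x).
Proof.
move=> bg; elim: n => [|n IHn].
  under [X in bounded_measurable X]funext do rewrite big_ord0.
  by split => //; exists 0 => x; rewrite normr0.
under [X in bounded_measurable X]funext do rewrite big_ord_recr/=.
exact: bounded_measurableD.
Qed.

Lemma RmeanD P g h : bounded_measurable g -> bounded_measurable h ->
  \int[P]_x (g x + h x) = \int[P]_x g x + \int[P]_x h x.
Proof.
by move=> bg bh; apply: RintegralD => //; exact: bounded_measurable_integrable.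
Qed.

Lemma RmeanZ P c g : bounded_measurable g ->
  \int[P]_x (c * g x) = c * \int[P]_x g x.
Proof. by move=> bg; apply: RintegralZl => //; exact: bounded_measurable_integrable. Qed.

Lemma Rmean_sum P n (g : nat -> T -> R) : (forall i, bounded_measurable (g i)) ->
  \int[P]_x (\sum_(i < n) g i x) = \sum_(i < n) \int[P]_x g i x.
Proof.
move=> bg; elim: n => [|n IHn].
  under eq_Rintegral do rewrite big_ord0.
  by rewrite big_ord0 Rintegral_cst// mul0r.
under eq_Rintegral do rewrite big_ord_recr/=.
by rewrite big_ord_recr/= RmeanD ?IHn//; exact: bounded_measurable_sum.
Qed.

Lemma EFin_Rmean P g : bounded_measurable g ->
  (\int[P]_x g x)%:E = (\int[P]_x (g x)%:E)%E.
Proof.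
move=> bg; rewrite /Rintegral fineK//.
by apply: integrable_fin_num => //; exact: bounded_measurable_integrable.
Qed.

End bounded_mean.

(** * Double means of a bounded kernel *)

Section kernel_mean.
Context {d} {T : measurableType d} {R : realType}.
Variables (K : T * T -> R) (L : R).
Hypothesis mK : measurable_fun setT K.
Hypothesis K0 : forall p, 0 <= K p.
Hypothesis KL : forall p, K p <= L.
Implicit Types P Q : probability T R.

Lemma bounded_measurable_kernel x : bounded_measurable (fun y => K (x, y)).
Proof.
split; last by exists L => y; rewrite ger0_norm.
by apply: measurableT_comp => //; exact: pair1_measurable.
Qed.

Lemma EFin_Rmean_kernel Q x :
  (\int[Q]_y K (x, y))%:E = (\int[Q]_y (K (x, y))%:E)%E.
Proof. by rewrite EFin_Rmean//; exact: bounded_measurable_kernel. Qed.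

Lemma bounded_measurable_mean Q : bounded_measurable (fun x => \int[Q]_y K (x, y)).
Proof.
split.
  apply/measurable_EFinP.
  rewrite (_ : _ \o _ = (fun x => \int[Q]_y (K (x, y))%:E)%E).
    apply: (@measurable_fun_fubini_tonelli_F _ _ T T R Q (EFin \o K)) => //.
    exact/measurable_EFinP.
  by apply/funext => x /=; exact: EFin_Rmean_kernel.
exists L => x; rewrite ger0_norm; last by apply: Rintegral_ge0.
rewrite -lee_fin EFin_Rmean_kernel.
have -> : L%:E = (\int[Q]_y L%:E)%E.
  by rewrite integral_cst//= probability_setT mule1.
apply: ge0_le_integral => //.
- by move=> y _; rewrite lee_fin.
- by apply/measurable_EFinP; exact: (bounded_measurable_kernel x).1.
- by move=> y _; rewrite lee_fin.
Qed.

Lemma EFin_Rmean_prod P Q :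
  (\int[P]_x \int[Q]_y K (x, y))%:E = (\int[(P \x Q)%E]_p (K p)%:E)%E.
Proof.
rewrite EFin_Rmean; last exact: bounded_measurable_mean.
rewrite (@fubini_tonelli1 _ _ T T R P Q (EFin \o K)).
- by apply: eq_integral => x _; rewrite EFin_Rmean_kernel.
- exact/measurable_EFinP.
- by move=> p; rewrite lee_fin.
Qed.

Lemma Rmean_prodC P Q : (forall x y, K (x, y) = K (y, x)) ->
  \int[P]_x \int[Q]_y K (x, y) = \int[Q]_x \int[P]_y K (x, y).
Proof.
move=> KC; apply: EFin_inj; rewrite !EFin_Rmean_prod.
rewrite (@fubini_tonelli1 _ _ T T R P Q (EFin \o K)).
- rewrite (@fubini_tonelli2 _ _ T T R Q P (EFin \o K)).
  + by apply: eq_integral => x _; apply: eq_integral => y _; rewrite /= KC.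
  + exact/measurable_EFinP.
  + by move=> p; rewrite lee_fin.
- exact/measurable_EFinP.
- by move=> p; rewrite lee_fin.
Qed.

End kernel_mean.

Lemma double_sum_recr {R : comNzRingType} (n : nat) (F : nat -> nat -> R) :
  (forall i j, F i j = F j i) ->
  \sum_(i < n.+1) \sum_(j < n.+1) F i j =
  \sum_(i < n) \sum_(j < n) F i j + 2 * (\sum_(i < n) F n i) + F n n.
Proof.
move=> FC; rewrite big_ord_recr/= big_ord_recr/= addrA; congr (_ + _).
under eq_bigr do rewrite big_ord_recr/= FC.
by rewrite big_split/= mulr2n mulrDl !mul1r addrA.
Qed.

(** * The method of conditional expectations for the energy *)

Section conditional_expectations.
Context {d} {T : measurableType d} {R : realType}.
Variables (K : T * T -> R) (L : R) (N : nat).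
Variables (P : nat -> probability T R) (V : nat -> set T).
Hypothesis mK : measurable_fun setT K.
Hypothesis K0 : forall p, 0 <= K p.
Hypothesis KL : forall p, K p <= L.
Hypothesis KC : forall x y, K (x, y) = K (y, x).
Hypothesis fullV : forall i E, (i < N)%N -> measurable E -> V i `<=` E ->
  P i (~` E) = 0%E.

Let a i j := \int[P i]_x \int[P j]_y K (x, y).

                                                                               
                                                                                
(** The external field [h] makes the induction work: once the last point [zn] is fixed, its
    interaction with the others becomes an extra field [2 * K (zn, x)]. The term [a i i] on the
    right accounts for the diagonal, where independent sampling would average [K] over pairs in one
    cell but the actual term is [K (z i, z i)]. *)
Lemma exists_energy_ge_mean n (h : T -> R) :
  (n <= N)%N -> bounded_measurable h ->
  exists2 z : nat -> T, (forall i, (i < n)%N -> V i (z i)) &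
    \sum_(i < n) \int[P i]_x h x + \sum_(i < n) \sum_(j < n) a i j <=
    \sum_(i < n) h (z i) + \sum_(i < n) \sum_(j < n) K (z i, z j) +
    \sum_(i < n) a i i.
Proof.
have bK := bounded_measurable_kernel mK K0 KL.
have bE := bounded_measurable_mean mK K0 KL.
elim: n h => [|n IHn] h nN bh.
  by exists (fun=> point) => //; rewrite !big_ord0 !addr0.
(* The part of the conditional mean that depends on the last point [x], the earlier points being
   still random and the diagonal left aside. *)
pose g x := h x + 2 * \sum_(i < n) \int[P i]_y K (x, y).
have bS : bounded_measurable (fun x => \sum_(i < n) \int[P i]_y K (x, y)).
  exact: (@bounded_measurable_sum _ _ _ n (fun i x => \int[P i]_y K (x, y))).
have bg : bounded_measurable g.
  by apply: bounded_measurableD => //; exact: bounded_measurableZ.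
have [mg [B gB]] := bg.
have [zn Vzn gzn] := exists_ge_Rmean (fun E => @fullV n E nN) mg gB.
have Eg : \int[P n]_x g x = \int[P n]_x h x + 2 * \sum_(i < n) a n i.
  rewrite RmeanD ?RmeanZ//; last exact: bounded_measurableZ.
  by rewrite (@Rmean_sum _ _ _ (P n) n (fun i x => \int[P i]_y K (x, y))).
rewrite {}Eg in gzn.
have [|z Vz IH] := IHn (fun x => h x + 2 * K (zn, x)) (ltnW nN).
  by apply: bounded_measurableD => //; exact: bounded_measurableZ.
exists (fun i => if i == n then zn else z i).
  move=> i; rewrite ltnS leq_eqVlt; case: eqVneq => [->//|_ /=]; exact: Vz.
rewrite (@double_sum_recr R n a); last by move=> i j; exact: Rmean_prodC.
pose z' i := if i == n then zn else z i.
rewrite (@double_sum_recr R n (fun i j => K (z' i, z' j))); last by move=> i j; exact: KC.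
rewrite !big_ord_recr/= /z' !eqxx.
have zE (i : 'I_n) : (if i == n :> nat then zn else z i) = z i.
  by rewrite (ltn_eqF (ltn_ord i)).
have E1 : \sum_(i < n) h (if i == n :> nat then zn else z i) = \sum_(i < n) h (z i).
  by apply: eq_bigr => i _; rewrite zE.
have E2 : \sum_(i < n) \sum_(j < n) K (if i == n :> nat then zn else z i,
    if j == n :> nat then zn else z j) = \sum_(i < n) \sum_(j < n) K (z i, z j).
  by apply: eq_bigr => i _; apply: eq_bigr => j _; rewrite !zE.
have E3 : \sum_(i < n) K (zn, if i == n :> nat then zn else z i) =
    \sum_(i < n) K (zn, z i).
  by apply: eq_bigr => i _; rewrite zE.
rewrite E1 E2 E3; move: IH gzn; rewrite big_split/= -mulr_sumr /g.
have -> : \sum_(i < n) \int[P i]_x (h x + 2 * K (zn, x)) =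
    \sum_(i < n) \int[P i]_x h x + 2 * \sum_(i < n) \int[P i]_y K (zn, y).
  rewrite mulr_sumr -big_split/=; apply: eq_bigr => i _.
  by rewrite RmeanD ?RmeanZ//; exact: bounded_measurableZ.
(* The new diagonal term [K (zn, zn)] is only bounded below by 0, while [a n n] occurs on both sides
   and cancels. *)
have := K0 (zn, zn); rewrite /a; lra.
Qed.

End conditional_expectations.

Section cells_points.
Context {R : realType} {M : pmetricType R}.
Variables (mu : probability (borelType M) R) (N : nat).
Variables (P : nat -> probability (borelType M) R) (V : nat -> set M).
Variables (e : nat -> R) (b : R).
Hypothesis cells : equal_cells mu N P V e b.

Lemma cells_integral (g : borelType M -> \bar R) :
  measurable_fun setT g -> (forall x, 0 <= g x)%E ->
  (\sum_(i < N) \int[P i]_x g x = N%:R%:E * \int[mu]_x g x)%E.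
Proof.
move=> mg g0.
rewrite -(@ge0_integral_measure_sum _ _ _ P setT measurableT g)//.
have N0 : 0 <= N%:R :> R by [].
rewrite -(@ge0_integral_mscale _ _ _ mu setT measurableT (NngNum N0))//.
apply: eq_measure_integral => A mA _.
exact: (cell_average cells).
Qed.

Lemma cells_Rmean (g : borelType M -> R) :
  bounded_measurable g -> (forall x, 0 <= g x) ->
  \sum_(i < N) \int[P i]_x g x = N%:R * \int[mu]_x g x.
Proof.
move=> bg g0; apply: EFin_inj; rewrite EFinM EFin_Rmean// -sumEFin.
rewrite -cells_integral.
- by apply: eq_bigr => i _; rewrite EFin_Rmean.
- by apply/measurable_EFinP; exact: bg.1.
- by move=> x; rewrite lee_fin.
Qed.

Lemma cells_fset (z : nat -> M) : (forall i, (i < N)%N -> V i (z i)) ->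
  exists2 D : {fset M}, #|` D| = N &
    forall F : M -> R, \sum_(x <- D) F x = \sum_(i < N) F (z i).
Proof.
move=> Vz; pose s := [seq z i | i <- iota 0 N].
have us : uniq s.
  rewrite map_inj_in_uniq ?iota_uniq// => i j; rewrite !mem_iota !add0n /= => iN jN zij.
  by apply: (cell_disjoint cells iN jN (Vz i iN)); rewrite zij; exact: Vz.
have ps : perm_eq (enum_fset [fset x in s]%fset) s.
  by apply: uniq_perm => // x; rewrite in_fset.
exists [fset x in s]%fset; first by rewrite (perm_size ps) size_map size_iota.
move=> F; rewrite (perm_big _ ps)/= big_map.
by rewrite -[X in iota 0 X]subn0 -/(index_iota 0 N) big_mkord.
Qed.

(** The energy bound is used with the distance as kernel and no field. Averaging the [P i] back to
    [mu] turns the double sum of means into [N^2] times the mean distance, and the loss is the sum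
    of the diagonal means. *)
Lemma cells_sum_dist_sup : compact [set: M] -> separable M ->
  ((N%:R ^+ 2)%:E * mean_dist mu - b%:E <= sum_dist_sup M N)%E.
Proof.
move=> cM sM; have [L distL] := mdist_bounded cM.
pose K (p : borelType M * borelType M) : R := mdist (p.1 : M) p.2.
have mK : measurable_fun setT K := measurable_mdist sM.
have K0 p : 0 <= K p by exact: mdist_ge0.
have KL p : K p <= L by exact: distL.
have KC x y : K (x, y) = K (y, x) by exact: mdist_sym.
have bK := bounded_measurable_kernel mK K0 KL.
have bE := bounded_measurable_mean mK K0 KL.
have b0 : bounded_measurable (fun _ : borelType M => 0 : R).
  by split => //; exists 0 => x; rewrite normr0.
have fullV i E iN := @cell_full _ _ _ _ _ _ _ _ cells i E iN.
have [z Vz H] :=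
  @exists_energy_ge_mean _ _ _ K L N P V mK K0 KL KC fullV N _ (leqnn N) b0.
pose a i j := \int[P i]_x \int[P j]_y K (x, y).
have {}H : \sum_(i < N) \sum_(j < N) a i j <=
    \sum_(i < N) \sum_(j < N) K (z i, z j) + \sum_(i < N) a i i.
  have E0 : \sum_(i < N) \int[P i]_x (0 : R) = 0.
    by rewrite big1// => i _; rewrite Rintegral_cst// mul0r.
  by move: H; rewrite E0 sumr_const mul0rn !add0r.
(* A mean distance inside one cell is at most the distance of some two points of the cell. These
   points are found by two uses of the mean value lemma, since [V i] may fail to be measurable. *)
have aii : \sum_(i < N) a i i <= b.
  apply: (le_trans _ (cell_sum cells)); apply: ler_sum => i _.
  have [mF [B FB]] := bE (P i).
  have [x Vx ax] := exists_ge_Rmean (fun E => fullV i E (ltn_ord i)) mF FB.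
  have [mFx [Bx FBx]] := bK x.
  have [y Vy xy] := exists_ge_Rmean (fun E => fullV i E (ltn_ord i)) mFx FBx.
  apply: (le_trans ax); apply: (le_trans xy).
  exact: (cell_diam cells (ltn_ord i)).
have {}H : N%:R ^+ 2 * \int[mu]_x \int[mu]_y K (x, y) <=
    \sum_(i < N) \sum_(j < N) K (z i, z j) + \sum_(i < N) a i i.
  apply: (le_trans _ H); rewrite le_eqVlt; apply/orP; left; apply/eqP/esym.
  rewrite expr2 -mulrA -cells_Rmean//; last by move=> x; exact: Rintegral_ge0.
  rewrite mulr_sumr; apply: eq_bigr => i _.
  rewrite -RmeanZ// -(@Rmean_sum _ _ _ (P i) N (fun j x => \int[P j]_y K (x, y)))//.
  by apply: eq_Rintegral => x _; rewrite cells_Rmean.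
have [D cD sD] := cells_fset Vz.
have sDK : \sum_(i < N) \sum_(j < N) K (z i, z j) = sum_dist D.
  rewrite /sum_dist sD; apply: eq_bigr => i _; by rewrite sD.
rewrite sDK in H; rewrite /mean_dist -(EFin_Rmean_prod mK K0 KL mu mu) -EFinM -EFinB.
apply: (@le_trans _ _ (sum_dist D)%:E).
  by rewrite lee_fin lerBlDr (le_trans H)// lerD2l.
by apply: ereal_sup_ubound; exists D.
Qed.

End cells_points.

                    

(** * Variance of a sum of independent indicators *)

Section variance.
Context {d d'} {T : measurableType d} {W : measurableType d'} {R : realType}.
Variables (B : set (T * W)) (eta : {sigma_finite_measure set W -> \bar R}).
Hypothesis mB : measurable B.
Implicit Types (P : probability T R) (S : W -> R).

Definition section_prob P (w : W) : R := fine (P (ysection B w)).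

Lemma measurable_section_prob P : measurable_fun setT (section_prob P).
Proof.
apply: measurableT_comp; first exact: fine_measurable.
exact: measurable_fun_ysection.
Qed.

Lemma section_prob_itv P w : 0 <= section_prob P w <= 1.
Proof.
rewrite fine_ge0//= -lee_fin fineK ?fin_num_measure ?probability_le1//.
all: exact: measurable_ysection.
Qed.

Lemma bounded_measurable_indic (A : set T) :
  measurable A -> bounded_measurable (\1_A : T -> R).
Proof.
move=> mA; split; first exact: measurable_indic.
by exists 1 => x; rewrite indicE; case: (_ \in _); rewrite ?normr1 ?normr0.
Qed.

(** The indicator minus [section_prob P w] is a centred Bernoulli variable, so the cross term with
    the constant [S w] disappears and its variance [v (1 - v)] is added. *)
Lemma mean_sqr_section P S w :
  (\int[P]_x ((S w + \1_B (x, w) - section_prob P w) ^+ 2)%:E =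
   (S w ^+ 2 + section_prob P w * (1 - section_prob P w))%:E)%E.
Proof.
set v := section_prob P w.
have mBw : measurable (ysection B w) by exact: measurable_ysection.
have bI := bounded_measurable_indic mBw.
have bC : bounded_measurable (fun _ : T => (S w - v) ^+ 2).
  by split => //; exists `|(S w - v) ^+ 2|.
have bZ := bounded_measurableZ (1 + 2 * (S w - v)) bI.
have E x : (S w + \1_B (x, w) - v) ^+ 2 =
    (S w - v) ^+ 2 + (1 + 2 * (S w - v)) * \1_(ysection B w) x.
  have -> : \1_B (x, w) = \1_(ysection B w) x :> R.
    by rewrite !indicE -[in LHS]mem_ysection.
  by rewrite indicE; case: (_ \in _); rewrite /=; ring.
under eq_integral do rewrite E.
rewrite -EFin_Rmean; last exact: bounded_measurableD.
congr EFin; rewrite RmeanD// RmeanZ// Rintegral_cst//= probability_setT/= mulr1.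
have -> : \int[P]_x \1_(ysection B w) x = v.
  by rewrite /Rintegral integral_indic// setIT.
by ring.
Qed.

Lemma variance_step P (V : set T) S :
  (forall E, measurable E -> V `<=` E -> P (~` E) = 0%E) ->
  measurable_fun setT S ->
  exists2 z, V z &
    (\int[eta]_w ((S w + \1_B (z, w) - section_prob P w) ^+ 2)%:E <=
     \int[eta]_w (S w ^+ 2)%:E +
     \int[eta]_w (section_prob P w * (1 - section_prob P w))%:E)%E.
Proof.
move=> fullV mS.
pose G (p : T * W) := ((S p.2 + \1_B p - section_prob P p.2) ^+ 2)%:E.
have mv := measurable_section_prob P.
have mG : measurable_fun setT G.
  apply/measurable_EFinP; apply: measurable_funX.
  apply: measurable_funB; last exact: measurableT_comp mv measurable_snd.
  apply: measurable_funD; first exact: measurableT_comp mS measurable_snd.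
  exact: measurable_indic.
have G0 p : (0 <= G p)%E by rewrite lee_fin sqr_ge0.
have [||z Vz gz] := @exists_le_mean _ _ _ P V fullV (fubini_F eta G).
- exact: measurable_fun_fubini_tonelli_F.
- by move=> x; exact: integral_ge0.
exists z => //; apply: (le_trans gz).
rewrite -fubini_tonelli1// fubini_tonelli2// -ge0_integralD//.
- rewrite le_eqVlt; apply/orP; left; apply/eqP.
  by apply: eq_integral => w _; rewrite -EFinD -mean_sqr_section.
- by move=> w _; rewrite lee_fin sqr_ge0.
- by apply/measurable_EFinP; exact: measurable_funX.
- move=> w _; have /andP[? ?] := section_prob_itv P w.
  by rewrite lee_fin mulr_ge0// subr_ge0.
- apply/measurable_EFinP; apply: measurable_funM => //.
  exact: measurable_funB.
Qed.

(** Points are chosen one after another. By Tonelli, the mean over the new point of the integrated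
    square equals the old integrated square plus the integrated variance, and some point of the cell
    does not exceed this mean ([variance_step]). *)
Lemma exists_discrepancy_le_variance (P : nat -> probability T R)
    (V : nat -> set T) (n : nat) :
  (forall i E, (i < n)%N -> measurable E -> V i `<=` E -> P i (~` E) = 0%E) ->
  exists2 z : nat -> T, (forall i, (i < n)%N -> V i (z i)) &
    (\int[eta]_w ((\sum_(i < n) (\1_B (z i, w) - section_prob (P i) w)) ^+ 2)%:E <=
     \sum_(i < n) \int[eta]_w (section_prob (P i) w * (1 - section_prob (P i) w))%:E)%E.
Proof.
elim: n => [|n IHn] fullV.
  exists (fun=> point) => //; rewrite big_ord0.
  by rewrite integral0_eq// => w _; rewrite big_ord0 expr0n.
have [i E iN|z Vz IH] := IHn; first by apply: fullV; exact: ltnW.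
pose S w := \sum_(i < n) (\1_B (z i, w) - section_prob (P i) w).
have mS : measurable_fun setT S.
  apply: (@measurable_sum _ _ _ _ _ _
    (fun (i : 'I_n) w => \1_B (z i, w) - section_prob (P i) w)) => i.
  apply: measurable_funB; last exact: measurable_section_prob.
  have mI : measurable_fun setT (\1_B : T * W -> R) by exact: measurable_indic.
  exact: measurableT_comp mI (pair1_measurable (z i)).
have [zn Vzn H] := variance_step (fun E => @fullV n E (ltnSn n)) mS.
exists (fun i => if i == n then zn else z i).
  move=> i; rewrite ltnS leq_eqVlt; case: eqVneq => [->//|_ /=]; exact: Vz.
rewrite big_ord_recr/=; apply: (le_trans _ (leeD IH (lexx _))); apply: le_trans H.
rewrite le_eqVlt; apply/orP; left; apply/eqP.
apply: eq_integral => w _; rewrite big_ord_recr/= eqxx addrA.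
congr ((_ + _ - _) ^+ 2)%:E; apply: eq_bigr => i _.
by rewrite (ltn_eqF (ltn_ord i)).
Qed.

End variance.

                                                                                 
Section finite_product.
Context {d1 d2} {T1 : measurableType d1} {T2 : measurableType d2} {R : realType}.
Variables (m1 : {finite_measure set T1 -> \bar R}).
Variables (m2 : {finite_measure set T2 -> \bar R}).

Lemma fin_num_product_measure : fin_num_fun (m1 \x m2)%E.
Proof.
apply/lty_fin_num_fun.
have E : ((m1 \x m2) setT = m1 setT * m2 setT)%E.
  by rewrite -setXTT; exact: product_measure1E.
suff : (m1 setT * m2 setT < +oo)%E by rewrite -E.
by rewrite lte_mul_pinfty// ?fin_num_measure// -ge0_fin_numE ?fin_num_measure.
Qed.

(** The product packed with its finiteness, so that it can serve as the measure [eta] on pairs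
    (radius, centre) in the variance bound. *)
Definition finite_product : {sigma_finite_measure set (T1 * T2)%type -> \bar R} :=
  HB.pack (m1 \x m2)%E
    (Measure_isFinite.Build _ _ _ (m1 \x m2)%E fin_num_product_measure).

End finite_product.

(** * Discrepancy of balls *)

Section cells_discrepancy.
Context {R : realType} {M : pmetricType R}.
Variable mu : probability (borelType M) R.
Variable xi : {finite_measure set (measurableTypeR R) -> \bar R}.
Variable c0 : R.
Hypothesis c0_ge0 : 0 <= c0.
Hypothesis cM : compact [set: M].
Hypothesis sM : separable M.
Hypothesis xi_lip : forall a b : R, radii M a -> radii M b -> a <= b ->
  (xi `[a, b[%classic <= (c0 * `|a - b|)%:E)%E.

(** The incidence relation between a point and a pair (radius, centre). Its section at such a pair
    is the closed ball, so [section_prob] becomes the probability of the ball. *)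
Definition ball_incidence : set (borelType M * (measurableTypeR R * borelType M)) :=
  [set p | mdist (p.1 : M) p.2.2 <= p.2.1].

Lemma measurable_ball_incidence : measurable ball_incidence.
Proof.
pose h (p : borelType M * (measurableTypeR R * borelType M)) : R :=
  mdist (p.1 : M) p.2.2 - p.2.1.
have mh : measurable_fun setT h.
  have m2 := @measurable_snd _ _ (borelType M) (measurableTypeR R * borelType M)%type.
  apply: measurable_funB; last exact: measurableT_comp measurable_fst m2.
  apply: (measurableT_comp (measurable_mdist sM)
    (g := fun p : borelType M * (measurableTypeR R * borelType M) => (p.1, p.2.2))).
  by apply: measurable_fun_pair => //; exact: measurableT_comp measurable_snd m2.
rewrite (_ : ball_incidence = [set p | h p <= 0]); first exact: measurable_sublevel_le.
by apply/seteqP; split => p /=; rewrite /ball_incidence/h/= subr_le0.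
Qed.

Lemma ysection_ball_incidence (r : R) (y : M) :
  ysection ball_incidence (r, y : borelType M) = cball y r.
Proof.
apply/seteqP.
by split => x; [move=> /ysectionP yx|move=> yx; apply/ysectionP]; exact: yx.
Qed.

Lemma measurable_cball (y : M) (r : R) : measurable (cball y r : set (borelType M)).
Proof.
rewrite -ysection_ball_incidence; apply: measurable_ysection.
exact: measurable_ball_incidence.
Qed.

Lemma radii_sup (A : set R) : A `<=` radii M -> has_sup A -> radii M (sup A).
Proof.
move=> Ar [A0 uA]; apply: (@closed_radii _ _ cM); apply: (closure_subset Ar).
exact: closure_sup.
Qed.

Lemma radii_inf (A : set R) : A `<=` radii M -> has_inf A -> radii M (inf A).
Proof.
move=> Ar [[x Ax] [l lA]].
have uNA : ubound [set - u | u in A] (- l) by move=> _ [u Au <-]; rewrite lerN2 lA.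
have NA0 : [set - u | u in A] !=set0 by exists (- x), x.
apply: (@closed_radii _ _ cM); apply: (closure_subset Ar) => U AU.
have NU : nbhs (sup [set - u | u in A]) [set - u | u in U].
  by rewrite -[sup _]opprK -/(inf A) nbhsNimage; exists U.
have [_ [[u Au <-] [u' Uu' uu']]] := closure_sup NA0 (ex_intro _ _ uNA) NU.
by exists u; split => //; rewrite -(oppr_inj uu').
Qed.

Variables (P : probability (borelType M) R) (V : set M) (e : R).
Hypothesis fullV : forall E : set (borelType M), measurable E -> V `<=` E ->
  P (~` E) = 0%E.
Hypothesis diamV : forall x x', V x -> V x' -> mdist x x' <= e.

Let v := section_prob ball_incidence P.

                                                                              
                                                                              
                                       
(** For a fixed centre [y], let [A] be the set of distances from [y] to the cell. A ball of radius
    below [inf A] misses the cell and one of radius at least [sup A] contains it, so the variance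
    vanishes outside [[inf A, sup A[]. This interval has length at most [e] by the triangle
    inequality. *)
Lemma variance_le_diameter :
  (\int[(xi \x mu)%E]_w (v w * (1 - v w))%:E <= (c0 * e / 4)%:E)%E.
Proof.
have mv := measurable_section_prob measurable_ball_incidence P.
have vitv := section_prob_itv measurable_ball_incidence P.
(* The mean value lemma for the zero function serves only to show that the cell is nonempty. *)
have [x0 Vx0 _] :=
  @exists_le_mean _ _ _ P V fullV (cst 0%E) (measurable_cst _) (fun=> lexx _).
have e0 : 0 <= e by rewrite (le_trans _ (diamV Vx0 Vx0)) ?mdist_self.
pose f w := (v w * (1 - v w))%:E.
have mf : measurable_fun setT f.
  apply/measurable_EFinP; apply: measurable_funM => //.
  exact: measurable_funB.
have f0 w : (0 <= f w)%E.
  by have /andP[? ?] := vitv w; rewrite lee_fin mulr_ge0// subr_ge0.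
have mI (a b : R) : measurable_fun setT (fun r : measurableTypeR R =>
    (\1_(`[a, b[%classic) r : R)%:E).
  by apply/measurable_EFinP; apply: measurable_indic; exact: measurable_itv.
rewrite (@fubini_tonelli2 _ _ _ _ _ xi mu f)//.
have -> : (c0 * e / 4)%:E = (\int[mu]_y (c0 * e / 4)%:E)%E.
  by rewrite integral_cst//= probability_setT mule1.
apply: ge0_le_integral => //.
- by move=> y _; exact: integral_ge0.
- exact: measurable_fun_fubini_tonelli_G.
move=> y _; rewrite /fubini_G/=.
pose A := [set mdist x y | x in V].
have Ar : A `<=` radii M by move=> _ [x Vx <-]; exists (x, y).
have A0 : A !=set0 by exists (mdist x0 y), x0.
have supA : has_sup A.
  split => //; exists (e + mdist x0 y) => _ [x Vx <-].
  by rewrite (le_trans (mdist_triangle _ x0 _))// lerD2r diamV.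
have infA : has_inf A by split => //; exists 0 => _ [x Vx <-]; exact: mdist_ge0.
have ab : inf A <= sup A.
  have Ax : A (mdist x0 y) by exists x0.
  apply: (@le_trans _ _ (mdist x0 y)).
    by apply: ge_inf => //; exact: infA.2.
  by apply: ub_le_sup => //; exact: supA.2.
have abe : sup A - inf A <= e.
  rewrite lerBlDr; apply: ge_sup => // _ [x Vx <-]; rewrite -lerBlDl.
  apply: lb_le_inf => // _ [x' Vx' <-].
  by rewrite lerBlDl (le_trans (mdist_triangle _ x' _))// lerD2r diamV.
(* The value 1/4 is the maximum of [v (1 - v)], obtained from the square of [v - 1/2]. *)
have vE r : v (r, y) * (1 - v (r, y)) <= 4^-1 * \1_(`[inf A, sup A[%classic) r.
  rewrite indicE; case: (boolP (r \in _)) => [_|].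
    by rewrite mulr1; have := sqr_ge0 (v (r, y) - 2^-1); rewrite expr2; lra.
  rewrite notin_setE/= in_itv/= => /negP; rewrite negb_and -ltNge -leNgt mulr0.
  have mc := measurable_cball y r.
  move=> /orP[ra|br].
    suff -> : v (r, y) = 0 by rewrite mul0r.
    rewrite /v /section_prob ysection_ball_incidence.
    rewrite -[cball y r]setCK fullV//; first exact: measurableC.
    move=> x Vx; rewrite /cball/=; apply/negP; rewrite -ltNge.
    by apply: (lt_le_trans ra); apply: ge_inf; [exact: infA.2|exists x].
  suff -> : v (r, y) = 1 by rewrite subrr mulr0.
  rewrite /v /section_prob ysection_ball_incidence.
  have := probability_setC P (measurableC mc); rewrite setCK => ->.
  rewrite fullV// ?sube0// => x Vx; rewrite /cball/=.
  by apply: le_trans br; apply: ub_le_sup; [exact: supA.2|exists x].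
apply: (@le_trans _ _ (\int[xi]_r (4^-1 * \1_(`[inf A, sup A[%classic) r)%:E)%E).
  apply: ge0_le_integral => //.
  - by apply: measurableT_comp mf _; exact: pair2_measurable.
  - by under eq_fun do rewrite EFinM; exact: measurable_funeM.
  - by move=> r _; rewrite lee_fin.
under eq_integral do rewrite EFinM.
rewrite ge0_integralZl_EFin// ?integral_indic ?setIT//.
apply: (@le_trans _ _ (4^-1%:E * (c0 * `|inf A - sup A|)%:E)%E).
  rewrite lee_pmul2l//.
  (* The hypothesis on [xi] concerns only endpoints in the set of radii; this set is compact, hence
     closed, so it contains the infimum and supremum of [A]. *)
  by apply: xi_lip => //; [exact: radii_inf|exact: radii_sup].
by rewrite -EFinM lee_fin ler0_norm ?subr_le0// opprB; have := ler_wpM2l c0_ge0 abe; lra.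
Qed.

End cells_discrepancy.

Lemma natr_card_fset_filter {R : realType} {K : choiceType} (D : {fset K}) (B : pred K) :
  (#|` [fset x in D | B x]%fset |)%:R = \sum_(x <- D) (B x)%:R :> R.
Proof.
have pD : perm_eq (enum_fset [fset x in D | B x]%fset) [seq x <- enum_fset D | B x].
  apply: uniq_perm => //; first exact: filter_uniq.
  by move=> x; rewrite !inE mem_filter andbC.
rewrite (perm_size pD) size_filter -sum1_count natr_sum big_mkcond.
by apply: eq_bigr => x _; case: (B x).
Qed.

Section cells_discrepancy_inf.
Context {R : realType} {M : pmetricType R}.
Variable mu : probability (borelType M) R.
Variable xi : {finite_measure set (measurableTypeR R) -> \bar R}.
Variables (N : nat) (P : nat -> probability (borelType M) R) (V : nat -> set M).
Variables (e : nat -> R) (b c0 : R).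
Hypothesis cells : equal_cells mu N P V e b.

Lemma local_discrepancy_cells (z : nat -> M) (D : {fset M}) (r : R) (y : M) :
  separable M -> #|` D| = N ->
  (forall F : M -> R, \sum_(x <- D) F x = \sum_(i < N) F (z i)) ->
  local_discrepancy mu (cball y r) D =
  \sum_(i < N) (\1_ball_incidence (z i : borelType M, (r, y : borelType M))
    - section_prob ball_incidence (P i) (r, y : borelType M)).
Proof.
move=> sM cD sD; rewrite /local_discrepancy cD natr_card_fset_filter sD sumrB.
congr (_ - _).
have mc : measurable (cball y r : set (borelType M)) by exact: measurable_cball.
apply: EFin_inj; rewrite EFinM -sumEFin fineK ?fin_num_measure//.
rewrite -(cell_average cells mc); apply: eq_bigr => i _.
by rewrite /section_prob ysection_ball_incidence fineK ?fin_num_measure.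
Qed.

(** Since the [P i] average to [mu], the local discrepancy of the chosen points is the sum of the
    centred indicators ([local_discrepancy_cells]). The variance bound then applies, with each cell
    contributing at most [c0 * e i / 4]. *)
Lemma cells_discrepancy_inf : compact [set: M] -> separable M -> 0 <= c0 ->
  (forall u v : R, radii M u -> radii M v -> u <= v ->
    (xi `[u, v[%classic <= (c0 * `|u - v|)%:E)%E) ->
  (discrepancy_inf mu xi N <= (c0 * b / 4)%:E)%E.
Proof.
move=> cM sM c0_ge0 xi_lip.
have mB : measurable (@ball_incidence R M) by exact: measurable_ball_incidence.
have fullV i E iN := @cell_full _ _ _ _ _ _ _ _ cells i E iN.
have [z Vz H] := @exists_discrepancy_le_variance _ _ (borelType M)
  (measurableTypeR R * borelType M)%type R _ (finite_product xi mu) mB P V N fullV.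
have [D cD sD] := cells_fset cells Vz.
apply: (@le_trans _ _ (mean_discrepancy mu xi D)).
  by apply: ereal_inf_lbound; exists D.
pose f (w : measurableTypeR R * borelType M) :=
  ((local_discrepancy mu (cball w.2 w.1) D) ^+ 2)%:E.
have fE w : f w = ((\sum_(i < N) (\1_ball_incidence (z i : borelType M, w)
    - section_prob ball_incidence (P i) w)) ^+ 2)%:E.
  by case: w => r y; rewrite /f (local_discrepancy_cells r y sM cD sD).
have mf : measurable_fun setT f.
  rewrite (_ : f = fun w => ((\sum_(i < N) (\1_ball_incidence (z i : borelType M, w)
    - section_prob ball_incidence (P i) w)) ^+ 2)%:E); last exact/funext.
  apply/measurable_EFinP; apply: measurable_funX.
  apply: (@measurable_sum _ _ _ _ _ _ (fun (i : 'I_N) w =>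
    \1_ball_incidence (z i : borelType M, w) - section_prob ball_incidence (P i) w)) => i.
  apply: measurable_funB; last exact: measurable_section_prob.
  have mI : measurable_fun setT (\1_(@ball_incidence R M) : _ -> R).
    exact: measurable_indic.
  exact: measurableT_comp mI (pair1_measurable _).
have f0 w : (0 <= f w)%E by rewrite lee_fin sqr_ge0.
apply: (@le_trans _ _ (\int[(xi \x mu)%E]_w f w)%E).
  (* The integral over the set of radii is enlarged to the whole line, the integrand being
     nonnegative. *)
  rewrite fubini_tonelli1// /mean_discrepancy /discrepancy.
  apply: ge0_subset_integral => //.
  - by apply: closed_measurable; exact: closed_radii.
  - exact: (@measurable_fun_fubini_tonelli_F _ _ _ _ _ mu f mf f0).
  - by move=> r _; apply: integral_ge0 => y _; rewrite lee_fin sqr_ge0.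
under eq_integral do rewrite fE.
apply: (le_trans H).
apply: (@le_trans _ _ (\sum_(i < N) (c0 * e i / 4)%:E)%E).
  apply: lee_sum => i _.
  exact: (variance_le_diameter mu c0_ge0 cM sM xi_lip (fun E => fullV i E (ltn_ord i))
    (fun x x' Vx Vx' => cell_diam cells (ltn_ord i) Vx Vx')).
rewrite sumEFin lee_fin -mulr_suml -mulr_sumr ler_pM2r// ler_wpM2l//.
exact: cell_sum cells.
Qed.

End cells_discrepancy_inf.

Theorem theorem1p1 (R : realType) (M : pmetricType R)
    (mu : probability (borelType M) R) (d : nat)
    (nu : {measure set (lebesgueType R d) -> \bar R})
    (O : set (lebesgueType R d)) (f : lebesgueType R d -> M) :
  compact [set: M] -> separable M -> (0 < d)%N ->
  rectification mu nu O f ->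
  (forall N : nat, (0 < N)%N ->
    ((N%:R ^+ 2)%:E * mean_dist mu
       - (d%:R * 2 ^+ d.-1 * Lip O f * N%:R `^ (1 - d%:R^-1))%:E
     <= sum_dist_sup M N)%E) /\
  (forall (xi : {finite_measure set (measurableTypeR R) -> \bar R}) (c0 : R),
    0 < c0 ->
    xi (~` radii M) = 0%E ->
    (forall a b : R, radii M a -> radii M b -> a <= b ->
      (xi `[a, b[%classic <= (c0 * `|a - b|)%:E)%E) ->
    forall N : nat, (0 < N)%N ->
      (discrepancy_inf mu xi N
       <= (d%:R * 2 ^ (d%:Z - 2) * Lip O f * c0 * N%:R `^ (1 - d%:R^-1))%:E)%E).
Proof.
move=> cM sM d0 rect; split => [N N0|xi c0 c0_gt0 _ xi_lip N N0].
  have [P [V [e cells]]] := rectifiable_equal_cells d0 rect N0.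
  exact: cells_sum_dist_sup cells cM sM.
have [P [V [e cells]]] := rectifiable_equal_cells d0 rect N0.
apply: (le_trans (cells_discrepancy_inf cells cM sM (ltW c0_gt0) xi_lip)).
have L0 := Lip_ge0 (rect_lip rect).
(* The exponent is an integer because it is negative for [d = 1]. The claimed constant is half of
   [c0 * b], twice the value [c0 * b / 4] obtained above, so nonnegativity of the product finishes
   the proof. *)
have -> : (2 : R) ^ (d%:Z - 2) = 2 ^+ d.-1 / 2.
  rewrite -(prednK d0) /= -[RHS]/(2 ^ (d.-1)%:Z * 2 ^ (-1)).
  by rewrite -expfzDr//; congr (_ ^ _); rewrite -natr1; ring.
rewrite lee_fin; set p : R := 2 ^+ d.-1; set t := N%:R `^ _.
have : 0 <= d%:R * p * Lip O f * c0 * t.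
  by rewrite !mulr_ge0 ?exprn_ge0 ?powR_ge0// ltW.
lra.
Qed.
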